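(* Let $n\ge 1$ and let $X_1,\ldots,X_n$ be nonempty metric spaces. Then $X=\prod_{i=1}^n X_i$ is straight if and only if all spaces $X_i$ are straight and one of the following conditions holds: (a) all spaces $X_i$ are precompact; (b) all spaces $X_i$ are ULC; (c) all but one of the spaces $X_i$ are both precompact and ULC.
   Context: All spaces are metric. A metric space $X$ is straight if whenever $X$ is the union of finitely many closed sets, a continuous function $f\colon X\to\mathbb{R}$ is uniformly continuous if and only if its restriction to each of these closed sets is uniformly continuous. A metric space $X$ is uniformly locally connected (ULC) if for every $\varepsilon>0$ there is $\delta>0$ such that any two points of $X$ at distance $<\delta$ lie in a connected subset of $X$ of diameter $<\varepsilon$. Precompact means totally bounded (equivalently, the metric completion is compact). A finite product $\prod_{i=1}^n X_i$ of metric spaces $(X_i,d_i)$ carries the metric $d(x,y)=\sum_i d_i(x_i,y_i)$. *)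

(* Defs.v *)
From HB Require Import structures.
From mathcomp Require Import all_boot all_order all_algebra.
From mathcomp Require Import all_classical all_reals all_analysis.

Set Implicit Arguments.
Unset Strict Implicit.
Unset Printing Implicit Defensive.

Import Order.TTheory GRing.Theory Num.Theory.
Import numFieldNormedType.Exports.

Local Open Scope classical_set_scope.
Local Open Scope ring_scope.

Section MetricNotions.
Context {R : realType}.

(* [sigL A f] is the restriction of [f] to the subtype [A], which carries the
   uniform structure induced by the ambient space. *)
Definition straight (X : metricType R) : Prop :=
  forall (m : nat) (C : 'I_m -> set X),
    (forall i, closed (C i)) -> \bigcup_i C i = [set: X] ->
  forall f : X -> R, continuous f ->
    (unif_continuous f <-> forall i, unif_continuous (sigL (C i) f)).

(* With this convention the diameter of the empty set is [-oo]. *)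
Definition diameter (X : metricType R) (A : set X) : \bar R :=
  ereal_sup [set (mdist x y)%:E | x in A & y in A].

Definition ULC (X : metricType R) : Prop :=
  forall e : R, 0 < e -> exists2 d : R, 0 < d &
    forall x y : X, mdist x y < d ->
      exists A : set X,
        [/\ connected A, A x, A y & (diameter A < e%:E)%E].

(* Not to be confused with the library's [precompact], which means relatively
   compact in the ambient space. *)
Definition totally_bounded (X : metricType R) : Prop :=
  forall e : R, 0 < e -> exists2 S : set X, finite_set S &
    \bigcup_(x in S) ball x e = [set: X].

End MetricNotions.

(* The product is a new constant so that its metric does not clash with the
   topology that the library puts on [forall i, X i]. *)
Definition sum_prod (R : realType) (n : nat) (X : 'I_n -> metricType R) :=
  forall i, X i.

Section SumProd.
Context (R : realType) (n : nat) (X : 'I_n -> metricType R).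

HB.instance Definition _ := Choice.copy (sum_prod X) (forall i, X i).

Definition sum_dist (x y : sum_prod X) : R := \sum_(i < n) mdist (x i) (y i).

Let sum_distxx x : sum_dist x x = 0.
Proof. by rewrite /sum_dist big1// => i _; rewrite mdistxx. Qed.

Let sum_dist_positivity x y : sum_dist x y = 0 -> x = y.
Proof.
move=> /eqP; rewrite psumr_eq0 => [/allP xy|i _]; last exact: mdist_ge0.
apply/functional_extensionality_dep => i; apply/mdist_positivity/eqP.
by apply: (implyP (xy i _)) => //; rewrite mem_index_enum.
Qed.

Let sum_dist_sym x y : sum_dist x y = sum_dist y x.
Proof. by apply: eq_bigr => i _; rewrite metric_sym. Qed.

Let sum_dist_triangle y x z : sum_dist x z <= sum_dist x y + sum_dist y z.
Proof.
by rewrite /sum_dist -big_split; apply: ler_sum => i _; exact: metric_triangle.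
Qed.

HB.instance Definition _ := isMetric.Build R (sum_prod X)
  sum_distxx sum_dist_positivity sum_dist_sym sum_dist_triangle.

End SumProd.

(* Main.v *)
Require Import Defs.
From HB Require Import structures.
From mathcomp Require Import all_boot all_order all_algebra.
From mathcomp Require Import all_classical all_reals all_analysis.
From mathcomp Require Import lra.

Set Implicit Arguments.
Unset Strict Implicit.
Unset Printing Implicit Defensive.

Import Order.TTheory GRing.Theory Num.Theory.
Import numFieldNormedType.Exports.

Local Open Scope classical_set_scope.
Local Open Scope ring_scope.

(** Everything rests on a description of straightness that mentions no
    functions ([straightP]): X is straight iff for every cover of X by two
    closed sets C and D, points of C and of D that are close to each other are
    close to a point of C `&` D.  Equivalently, no sequence of pairs of points
    at distance tending to 0 is separated, in balls of a fixed radius, by one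
    partition of X minus a closed set into two open sets.

    Necessity.  If X_i is not totally bounded it contains an infinite sequence
    (x_k) with distances bounded below.  If moreover X_j is not ULC, there are
    pairs (a_k, b_k) of points of X_j with d(a_k, b_k) -> 0, separated by an
    open partition of the ball of fixed radius about a_k
    ([ULC_of_unsplit_balls]).  Moving the k-th partition to the column over x_k
    makes all of them part of one closed cover of the product, which violates
    the criterion ([placed_ULC_factor]).  So a factor that is not totally
    bounded forces all the other factors to be ULC, and (a), (b), (c) are what
    remains possible.

    Sufficiency of (b) and (c).  In a ULC space two close points are joined by
    a small connected set, and a connected set cannot pass from C to D without
    meeting C `&` D ([ULC_crossing]); this allows moving one coordinate at a
    time.  If all factors are ULC, this moves p to q ([ULC_prod_placed]).  If
    the ULC factors are also totally bounded, their coordinates can be moved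
    to points of a finite net, which leaves finitely many slices isometric to
    the remaining straight factor ([placed_prod_one_factor]).

    Sufficiency of (a).  A point of the completion of X is handled through a
    decreasing sequence of open sets B 0, B 1, ... shrinking to it.  For a
    totally bounded space, straightness says that such a sequence is undivided:
    if two disjoint open sets cover some B k, then one of them alone contains
    some B l ([placed_undivided]).  The point is that this passes to products
    ([box_undivided]).  It is clear at points of the product, and the
    coordinates are then replaced by completion points one at a time.  In one
    such replacement, the sequence B i in the new coordinate is undivided, so
    that all slices near it belong to the same open set U; if no box were
    contained in U, the traces of the other open set on a sequence of parallel
    lines would be clopen sets accumulating at the completion point but
    locally finite elsewhere, and an undivided sequence does not admit such a
    family ([undivided_locally_finite]). *)

(** * Straightness in terms of closed covers *)

Section MetricTools.
Context {R : realType} {X : metricType R}.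
Implicit Types (A C D U V : set X) (x y z : X).

Lemma open_mdistP U :
  open U <-> forall x, U x -> exists2 e, 0 < e & forall y, mdist x y < e -> U y.
Proof.
rewrite openE; split=> [oU x /oU/metricType_numDomainType.nbhs_mdistP|oU x Ux].
  by move=> [e e0 eU]; exists e => // y /eU.
apply/metricType_numDomainType.nbhs_mdistP.
by have [e e0 eU] := oU x Ux; exists e => // y /eU.
Qed.

Lemma open_mball x (e : R) : open [set y | mdist x y < e].
Proof.
apply/open_mdistP => y /= xye; exists (e - mdist x y); first by rewrite subr_gt0.
by move=> z; have := metric_triangle x y z; lra.
Qed.

Lemma pos_below (a b : R) : 0 < a -> 0 < b ->
  exists2 e, 0 < e & e <= a /\ e <= b.
Proof.
move=> a0 b0; exists (Num.min a b); first by rewrite lt_min a0.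
by rewrite !ge_min !lexx orbT.
Qed.

Lemma invS_lt (e : R) : 0 < e -> exists k : nat, k.+1%:R^-1 < e.
Proof.
move=> e0; exists (Num.truncn e^-1).
by rewrite invf_plt ?posrE//; exact: truncnS_gt.
Qed.

Lemma common_radius (T : choiceType) (S : set T) (P : T -> R -> Prop) :
  finite_set S -> (forall i d d', d' <= d -> P i d -> P i d') ->
  (forall i, S i -> exists2 d, 0 < d & P i d) ->
  exists2 d, 0 < d & forall i, S i -> P i d.
Proof.
move=> /finite_seqP[s ->] mono; elim: s => [|a s IH] Ps; first by exists 1.
have [|d d0 dP] := IH; first by move=> i si; apply: Ps; rewrite /= inE si orbT.
have [|d' d'0 d'P] := Ps a; first by rewrite /= inE eqxx.
exists (Num.min d d'); first by rewrite lt_min d0.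
move=> i; rewrite /= inE => /predU1P[->|si].
  by apply: mono d'P; rewrite ge_min lexx orbT.
by apply: mono (dP _ si); rewrite ge_min lexx.
Qed.

Lemma unif_continuous_mdistP (f : X -> R) : unif_continuous f <->
  forall e, 0 < e -> exists2 d, 0 < d &
    forall x y, mdist x y < d -> `|f x - f y| < e.
Proof.
split=> [/unif_continuousP uf e e0|uf].
  have [d d0 df] := uf e e0; exists d => // x y xy.
  by apply: (df (x, y)); rewrite ballEmdist.
apply/unif_continuousP => e /uf[d d0 df]; exists d => // -[x y].
by rewrite ballEmdist; exact: df.
Qed.

Lemma unif_continuous_sigLP A (f : X -> R) : unif_continuous (sigL A f) <->
  forall e, 0 < e -> exists2 d, 0 < d &
    forall x y, A x -> A y -> mdist x y < d -> `|f x - f y| < e.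
Proof.
split=> [/unif_continuousP uf e e0|uf].
  have [d d0 df] := uf e e0; exists d => // x y Ax Ay xy.
  apply: (df (exist _ x (mem_set Ax), exist _ y (mem_set Ay))).
  by rewrite -initial_ballE /= ballEmdist.
apply/unif_continuousP => e /uf[d d0 df]; exists d => // -[[x Ax] [y Ay]].
rewrite -initial_ballE /= ballEmdist => xy.
by apply: df => //; exact: set_mem.
Qed.

End MetricTools.

(** Both members of the pair are within e of the intersection, up to d; only
    the distance from x is recorded. If C and D are disjoint, the condition
    says that their distance is positive. *)
Definition uniformly_placed (R : realType) (X : metricType R) : Prop :=
  forall C D : set X, closed C -> closed D -> C `|` D = [set: X] ->
  forall e : R, 0 < e -> exists2 d : R, 0 < d &
    forall x y, C x -> D y -> mdist x y < d ->
      exists2 z, (C `&` D) z & mdist x z < e.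

Section StraightPlaced.
Context {R : realType} {X : metricType R}.

(** The cap e makes the function total, including over the empty set, where it
    is constantly e. *)
Definition capped_dist (A : set X) (e : R) (x : X) : R :=
  inf ([set mdist x z | z in A] `|` [set e]).

Lemma capped_dist_lt A e x : capped_dist A e x < e ->
  exists2 z, A z & mdist x z < e.
Proof.
move=> /inf_lt[]; first by exists e; right.
by move=> _ [[z Az <-] xz|->]; [exists z|rewrite ltxx].
Qed.

Lemma capped_dist_ge0 A e x : 0 < e -> 0 <= capped_dist A e x.
Proof.
move=> e0; apply: lb_le_inf; first by exists e; right.
by move=> _ [[z _ <-]|->]; [exact: mdist_ge0|exact: ltW].
Qed.

Lemma capped_dist_ler A e x y : 0 < e ->
  capped_dist A e x <= mdist x y + capped_dist A e y.
Proof.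
move=> e0; rewrite -lerBlDl; apply: lb_le_inf; first by exists e; right.
have lb : has_lbound ([set mdist x z | z in A] `|` [set e]).
  by exists 0 => _ [[z _ <-]|->]; [exact: mdist_ge0|exact: ltW].
move=> _ [[z Az <-]|->]; rewrite lerBlDl.
  apply: le_trans (metric_triangle x y z).
  by apply: ge_inf => //; left; exists z.
apply: (@le_trans _ _ e); first by apply: ge_inf => //; right.
by rewrite lerDr mdist_ge0.
Qed.

Lemma capped_dist_eq0 A e x : 0 < e -> A x -> capped_dist A e x = 0.
Proof.
move=> e0 Ax; apply/eqP; rewrite eq_le capped_dist_ge0// andbT.
apply: ge_inf; last by left; exists x => //; exact: mdistxx.
by exists 0 => _ [[z _ <-]|->]; [exact: mdist_ge0|exact: ltW].
Qed.

Lemma capped_dist_lipschitz A e x y : 0 < e ->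
  `|capped_dist A e x - capped_dist A e y| <= mdist x y.
Proof.
move=> e0; rewrite ler_norml.
have := capped_dist_ler A x y e0; have := capped_dist_ler A y x e0.
by rewrite (metric_sym y x); lra.
Qed.

(** The test function is the capped distance to C `&` D on C and 0 on D: it is
    1-Lipschitz on each of the two sets, so it is uniformly continuous, while
    it takes the value e at points of C that are e-far from C `&` D. *)
Lemma straight_placed : straight X -> uniformly_placed X.
Proof.
move=> sX C D cC cD CD e e0.
pose h := capped_dist (C `&` D) e.
pose f x := if x \in C then h x else 0.
have fC x : C x -> f x = h x by move=> Cx; rewrite /f mem_set.
have fD x : D x -> f x = 0.
  move=> Dx; rewrite /f; case: ifPn => // /set_mem Cx.
  by rewrite /h capped_dist_eq0.
have h_lip x y : `|h x - h y| <= mdist x y by exact: capped_dist_lipschitz.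
have f_cont : continuous f.
  move=> x; apply/cvgrPdist_lt => r r0.
  have near_x U : open U -> U x ->
      (forall y, U y -> mdist x y < r -> `|f x - f y| < r) ->
      \forall y \near x, `|f x - f y| < r.
    move=> /open_mdistP oU /oU[d d0 dU] fU.
    apply/metricType_numDomainType.nbhs_mdistP.
    exists (Num.min d r); first by rewrite /= lt_min d0.
    by move=> y; rewrite /= lt_min => /andP[/dU Uy]; exact: fU.
  have [Dx|nDx] := pselect (D x); last first.
    apply: (near_x (~` D)) => //; first exact: closed_openC.
    have C_of y : ~ D y -> C y by have : [set: X] y by []; rewrite -CD => -[].
    move=> y nDy xy; rewrite !fC; [|exact: C_of..].
    exact: le_lt_trans (h_lip _ _) xy.
  have [Cx|nCx] := pselect (C x); last first.
    apply: (near_x (~` C)) => //; first exact: closed_openC.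
    have D_of y : ~ C y -> D y by have : [set: X] y by []; rewrite -CD => -[].
    by move=> y nCy xy; rewrite !fD ?subrr ?normr0//; exact: D_of.
  apply: (near_x setT) => //; first exact: openT.
  move=> y _ xy; have [Cy|nCy] := pselect (C y).
    by rewrite !fC//; exact: le_lt_trans (h_lip _ _) xy.
  have : [set: X] y by [].
  by rewrite -CD => -[//|Dy]; rewrite !fD// subrr normr0.
pose K (i : 'I_2) := if i == ord0 then C else D.
have [||_ glue] := sX 2 K _ _ f f_cont.
- by move=> i; rewrite /K; case: ifP.
- rewrite -CD; apply/seteqP; split=> [x [i _]|x [Cx|Dx]].
  + by rewrite /K; case: ifP; [left|right].
  + by exists ord0.
  + by exists ord_max.
have /glue : forall i, unif_continuous (sigL (K i) f).
  move=> i; apply/unif_continuous_sigLP => r r0; exists r => // x y.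
  rewrite /K; case: ifP => _ Kx Ky xy; last by rewrite !fD// subrr normr0.
  by rewrite !fC//; exact: le_lt_trans (h_lip _ _) xy.
move=> /unif_continuous_mdistP/(_ e e0)[d d0 df]; exists d => // x y Cx Dy xy.
apply: capped_dist_lt; have := df x y xy; rewrite fC// fD// subr0.
exact: le_lt_trans (ler_norm _).
Qed.

(** Given close points x and y, consider the set S of indices i such that C i
    contains a point near x at which f is close to f x. If y lies in C i for
    some i in S, then f y is close to f x. Otherwise the union of the C i for
    i in S and the union of the others form a closed cover to which the
    hypothesis applies: it gives a point z near x in C j and C l with j in S
    and l outside S. As f is uniformly continuous on C j, f z is close to f x,
    and l can be added to S. This happens at most m times. *)
Lemma placed_straight : uniformly_placed X -> straight X.
Proof.
move=> pX m C cC CT f _; split=> [/unif_continuous_mdistP uf i|uf].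
  apply/unif_continuous_sigLP => e /uf[d d0 df].
  by exists d => // x y _ _; exact: df.
apply/unif_continuous_mdistP.
have inC x : exists i, C i x.
  by have : [set: X] x by []; rewrite -CT => -[i _ Cix]; exists i.
have uC e : 0 < e -> exists2 d, 0 < d & forall i x y, C i x -> C i y ->
    mdist x y < d -> `|f x - f y| < e.
  move=> e0; have [|||d d0 dC] := @common_radius R _ [set: 'I_m]
    (fun i d => forall x y, C i x -> C i y -> mdist x y < d -> `|f x - f y| < e).
  - exact: finite_finset.
  - by move=> i d d' dd' dC x y Cx Cy xy; exact: dC Cx Cy (lt_le_trans xy dd').
  - by move=> i _; have /unif_continuous_sigLP/(_ e e0) := uf i.
  by exists d => // i; exact: dC.
pose CS (S : {set 'I_m}) := \bigcup_(i in [set` S]) C i.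
have pS e : 0 < e -> exists2 d, 0 < d & forall (S : {set 'I_m}) x y,
    CS S x -> CS (~: S)%SET y -> mdist x y < d ->
    exists2 z, (CS S `&` CS (~: S)%SET) z & mdist x z < e.
  have cCS S : closed (CS S).
    by apply: closed_bigcup => // i _; exact: cC.
  move=> e0; have [|||d d0 dS] := @common_radius R _ [set: {set 'I_m}]
    (fun S d => forall x y, CS S x -> CS (~: S)%SET y -> mdist x y < d ->
    exists2 z, (CS S `&` CS (~: S)%SET) z & mdist x z < e).
  - exact: finite_finset.
  - by move=> i d d' dd' dC x y Cx Cy xy; exact: dC Cx Cy (lt_le_trans xy dd').
  - move=> S _; apply: pX => //; apply/seteqP; split=> // x _.
    have [i Cix] := inC x; have [iS|iS] := boolP (i \in S); [left|right].
      by exists i.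
    by exists i => //; rewrite /= inE.
  by exists d => // S; exact: dS.
pose reach e x (S : {set 'I_m}) := forall i, i \in S ->
  exists w, [/\ C i w, mdist x w < e & `|f x - f w| < e].
(* at each stage either f x and f y are close, or more than k of the sets C i
   have been reached *)
suff grow k e : 0 < e -> exists2 d, 0 < d & forall x y, mdist x y < d ->
    `|f x - f y| < e \/ exists2 S : {set 'I_m}, (k < #|S|)%N & reach e x S.
  move=> e /(grow m)[d d0 dP]; exists d => // x y /dP[//|[S]].
  by rewrite ltnNge (leq_trans (max_card _))// card_ord.
elim: k e => [|k IH] e e0.
  exists 1 => // x y _; right; have [i Cix] := inC x.
  exists [set i]%SET; first by rewrite cards1.
  by move=> j; rewrite inE => /eqP->; exists x; rewrite mdistxx subrr normr0.
have [|d1 d1_gt0 fC] := uC (e / 2); first by rewrite divr_gt0.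
have [||e1 e1_gt0 [e1e e1d]] := @pos_below R (e / 4) (d1 / 4); rewrite ?divr_gt0//.
have [d2 d2_gt0 meetS] := pS e1 e1_gt0.
have [||e2 e2_gt0 [e2e e2d]] := @pos_below R e1 (d2 / 2); rewrite ?divr_gt0//.
have [d3 d3_gt0 reachP] := IH e2 e2_gt0.
exists (Num.min d3 e2); first by rewrite lt_min d3_gt0.
move=> x y; rewrite lt_min => /andP[/reachP[fxy _|[S cardS xS] xy]].
  by left; lra.
have [[i iS Ciy]|nSy] := pselect (CS S y).
  left; have [w [Ciw xw fxw]] := xS i iS.
  have : `|f w - f y| < e / 2.
    apply: fC Ciw Ciy _; have := metric_triangle w x y.
    by rewrite (metric_sym w x); lra.
  by have := ler_distD (f w) (f x) (f y); lra.
have /card_gt0P[i iS] : (0 < #|S|)%N by exact: leq_trans cardS.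
have [w [Ciw xw _]] := xS i iS.
have [|||z [[j jS Cjz] [l lS Clz]] wz] := meetS S w y.
- by exists i.
- have [l Cly] := inC y; exists l => //; rewrite /= inE; apply/negP => lS.
  by apply: nSy; exists l.
- by have := metric_triangle w x y; rewrite (metric_sym w x); lra.
right; exists (l |: S)%SET.
  by move: lS; rewrite /= inE cardsU1 => ->; rewrite add1n ltnS.
move=> r; rewrite !inE => /predU1P[->|rS].
  have [v [Cjv xv fxv]] := xS j jS.
  have xz := metric_triangle x w z.
  exists z; split => //; first by lra.
  have : `|f v - f z| < e / 2.
    apply: fC Cjv Cjz _; have := metric_triangle v x z.
    by rewrite (metric_sym v x); lra.
  by have := ler_distD (f v) (f x) (f z); lra.
by have [v [Cv xv fv]] := xS r rS; exists v; split=> //; lra.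
Qed.

Lemma straightP : straight X <-> uniformly_placed X.
Proof. by split; [exact: straight_placed|exact: placed_straight]. Qed.

End StraightPlaced.

(** * Uniform local connectedness *)

Section ULCFacts.
Context {R : realType} {X : metricType R}.

(** Compared with [uniformly_placed], d no longer depends on the cover; this is
    what allows the result to be applied to all slices of a product at once. *)
Lemma ULC_crossing : ULC X -> forall e : R, 0 < e ->
  exists2 d, 0 < d & forall C D : set X, closed C -> closed D ->
    C `|` D = [set: X] -> forall x y, C x -> D y -> mdist x y < d ->
    exists2 z, (C `&` D) z & mdist x z < e.
Proof.
move=> ulcX e e0; have [d d0 linkX] := ulcX e e0; exists d => // C D cC cD CD.
move=> x y Cx Dy /linkX[A [conA Ax Ay diamA]].
suff [z Az CDz] : exists2 z, A z & (C `&` D) z.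
  exists z => //; rewrite -lte_fin; apply: le_lt_trans diamA.
  by apply: ereal_sup_ubound; exists x => //; exists z.
apply: contrapT => noz.
have AC : A `&` C = A.
  apply: conA; first by exists x.
    exists (~` D); first exact: closed_openC.
    apply/seteqP; split=> z [Az].
      by move=> Cz; split=> // Dz; apply: noz; exists z.
    by move=> nDz; split=> //; have : [set: X] z by []; rewrite -CD => -[].
  by exists C.
by apply: noz; exists y => //; split => //; move: Ay; rewrite -AC => -[].
Qed.

Definition splits (B U V : set X) :=
  [/\ open U, open V, U `&` V = set0 & U `|` V = B].

Definition quasicomponent (B : set X) (x : X) : set X :=
  [set z | B z /\ forall U V, splits B U V -> U x -> U z].

Lemma splitsC B U V : splits B U V -> splits B V U.
Proof. by case=> oU oV UV UVB; split=> //; rewrite 1?setIC 1?setUC. Qed.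

(** Each point outside the quasicomponent is removed by a splitting, whose
    second member is an open set disjoint from the quasicomponent. *)
Lemma open_setC_quasicomponent B x :
  open B -> open (B `\` quasicomponent B x).
Proof.
move=> oB; rewrite openE => w [Bw nQw].
have [U [V [sUV Ux nUw]]] :
    exists U, exists V, [/\ splits B U V, U x & ~ U w].
  apply: contrapT => noUV; apply: nQw; split=> // U V sUV Ux.
  by apply: contrapT => nUw; apply: noUV; exists U; exists V.
have [_ oV UV0 UVB] := sUV.
have Vw : V w by move: Bw; rewrite -UVB => -[].
apply: (filterS _ (open_nbhs_nbhs (conj oV Vw))) => v Vv; split.
  by rewrite -UVB; right.
by move=> [_ /(_ U V sUV Ux) Uv]; have : (U `&` V) v by []; rewrite UV0.
Qed.

(** Quasicomponents need not be connected, but open ones are: a clopen part S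
    of an open quasicomponent is clopen in B, because the quasicomponent is
    clopen in B, so S and its complement would split B. *)
Lemma connected_quasicomponent B x : open B -> B x ->
  open (quasicomponent B x) -> connected (quasicomponent B x).
Proof.
set Q := quasicomponent B x.
move=> oB Bx oQ S [s Ss] [W oW SW] [K cK SK].
have oS : open S by rewrite SW; exact: openI.
have SQ : S `<=` Q by rewrite SW => z [].
have sS : splits B S (B `\` S).
  split=> //; last 2 first.
  - by rewrite setDE setICA setICr setI0.
  - by apply/setDUK => z /SQ[].
  have -> : B `\` S = (B `\` Q) `|` (Q `&` ~` K).
    apply/seteqP; split=> z.
      move=> [Bz nSz]; have [Qz|nQz] := pselect (Q z); [right|by left].
      by split=> // Kz; apply: nSz; rewrite SK.
    move=> [[Bz nQz]|[[Bz Qz] nKz]]; split=> //; first by move=> /SQ.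
    by rewrite SK => -[].
  apply: openU; first exact: open_setC_quasicomponent.
  by apply: openI => //; exact: closed_openC.
apply/seteqP; split=> // z Qz; have [Sx|nSx] := pselect (S x).
  by have [_ /(_ _ _ sS Sx)] := Qz.
have /splitsC sS' := sS.
by have [_ /(_ _ _ sS' (conj Bx nSx))[]] := SQ _ Ss.
Qed.

(** Since nearby points are never split by a ball of radius e, the
    quasicomponent of x in a ball contains a ball about each of its points
    (by the same property at smaller scales), hence is open and connected. It
    is then the connected set required in the definition of ULC. The use of
    open partitions in place of connected sets is what turns a failure of ULC
    into closed covers. *)
Lemma ULC_of_unsplit_balls :
  (forall e : R, 0 < e -> exists2 d, 0 < d & forall (x y : X) U V,
     mdist x y < d -> splits [set z | mdist x z < e] U V -> U x -> ~ V y) ->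
  ULC X.
Proof.
move=> unsplit.
have near_unsplit (e : R) : 0 < e -> exists2 d, 0 < d & forall x y,
    mdist x y < d -> quasicomponent [set z | mdist x z < e] x y.
  move=> e0; have [d d0 dP] := unsplit e e0.
  have [r r0 [rd re]] := pos_below d0 e0; exists r => // x y xy.
  split=> [|U V sUV Ux]; first exact: lt_le_trans re.
  have [_ _ _ UVB] := sUV.
  have : [set z | mdist x z < e] y by exact: lt_le_trans re.
  rewrite -UVB => -[//|Vy]; exfalso.
  exact: (dP x y U V (lt_le_trans xy rd) sUV Ux).
move=> e e0; have [|d d0 dP] := near_unsplit (e / 3); first by rewrite divr_gt0.
(* the radius e / 3 makes the diameter at most 2 e / 3, strictly below e *)
exists d => // x y xy; set B := [set z | mdist x z < e / 3].
have oB : open B by exact: open_mball.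
have Bx : B x by rewrite /B /= mdistxx divr_gt0.
exists (quasicomponent B x); split; [|by []|exact: dP|]; last first.
  apply: (@le_lt_trans _ _ ((2 / 3 * e)%:E)); last by rewrite lte_fin; lra.
  apply: ge_ereal_sup => _ [a [Ba _] [b [Bb _] <-]]; rewrite lee_fin.
  have := metric_triangle a x b; rewrite (metric_sym a x).
  by move: Ba Bb; rewrite /B /=; lra.
apply: connected_quasicomponent => //; apply/open_mdistP => z [Bz Qz].
have [r r0 rB] := (open_mdistP B).1 oB z Bz.
have [r' r'0 r'P] := near_unsplit r r0; exists r' => // w zw.
have [zwr qzw] := r'P z w zw; split=> [|U V sUV Ux]; first exact: rB.
(* a splitting of the large ball restricts to the small ball about z *)
suff [] : (U `&` [set v | mdist z v < r]) w by [].
apply: (qzw _ (V `&` [set v | mdist z v < r])) => /=.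
  have [oU oV UV0 UVB] := sUV; split.
  - by apply: openI => //; exact: open_mball.
  - by apply: openI => //; exact: open_mball.
  - by rewrite setIACA UV0 set0I.
  - by rewrite -setIUl UVB; apply/setIidPr => v /rB.
by split; [exact: Qz sUV Ux|rewrite /= mdistxx].
Qed.

End ULCFacts.

(** * Coordinates and slices of products *)

Section Coordinates.
Context {R : realType} {n : nat} {X : 'I_n -> metricType R}.
Implicit Types (p q : sum_prod X) (i j : 'I_n).

Definition upd p i (x : X i) : sum_prod X := dfwith p i x.

Arguments upd : simpl never.

Lemma upd_eq p i (x : X i) : upd p x i = x.
Proof. exact: dfwithin. Qed.

Lemma upd_neq p i j (x : X i) : i != j -> upd p x j = p j.
Proof. exact: dfwithout. Qed.

Lemma upd_id p i : upd p (p i) = p.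
Proof.
apply/functional_extensionality_dep => j.
by have [<-|ij] := eqVneq i j; [rewrite upd_eq|rewrite upd_neq].
Qed.

Lemma mdist_prodE p q : mdist p q = \sum_i mdist (p i) (q i).
Proof. by []. Qed.

Lemma mdist_coord p q i : mdist (p i) (q i) <= mdist p q.
Proof.
rewrite mdist_prodE (bigD1 i)//= lerDl.
by apply: sumr_ge0 => j _; exact: mdist_ge0.
Qed.

Lemma mdist_upd p i (x y : X i) : mdist (upd p x) (upd p y) = mdist x y.
Proof.
rewrite mdist_prodE (bigD1 i)//= !upd_eq big1 ?addr0// => j ji.
by rewrite !upd_neq 1?eq_sym// mdistxx.
Qed.

Lemma mdist_updr p i (x : X i) : mdist p (upd p x) = mdist (p i) x.
Proof. by rewrite -{1}(upd_id p i) mdist_upd. Qed.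

Lemma mdist_upd2 p q i (x : X i) : mdist (upd p x) (upd q x) <= mdist p q.
Proof.
rewrite !mdist_prodE; apply: ler_sum => j _.
have [<-|ij] := eqVneq i j; first by rewrite !upd_eq mdistxx mdist_ge0.
by rewrite !upd_neq.
Qed.

Lemma open_coord i (U : set (X i)) : open U -> open [set p : sum_prod X | U (p i)].
Proof.
move=> /open_mdistP oU; apply/open_mdistP => p /oU[e e0 eU]; exists e => // q pq.
by apply: eU; exact: le_lt_trans (mdist_coord _ _ _) pq.
Qed.

Lemma open_slice p i (W : set (sum_prod X)) : open W -> open [set x : X i | W (upd p x)].
Proof.
move=> /open_mdistP oW; apply/open_mdistP => x /oW[e e0 eW]; exists e => // y xy.
by apply: eW; rewrite mdist_upd.
Qed.

Lemma closed_coord i (C : set (X i)) :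
  closed C -> closed [set p : sum_prod X | C (p i)].
Proof.
move=> /closed_openC oC; rewrite -openC; exact: (open_coord oC).
Qed.

Lemma closed_slice p i (C : set (sum_prod X)) :
  closed C -> closed [set x : X i | C (upd p x)].
Proof.
move=> /closed_openC oC; rewrite -openC; exact: (open_slice p i oC).
Qed.

Lemma setU_slice p i (C D : set (sum_prod X)) : C `|` D = setT ->
  [set x : X i | C (upd p x)] `|` [set x | D (upd p x)] = setT.
Proof.
by move=> CD; apply/seteqP; split=> // x _; have : [set: sum_prod X] (upd p x) by []; rewrite -CD.
Qed.

End Coordinates.
Arguments upd : simpl never.
Arguments open_slice {R n X} p i {W}.
Arguments closed_slice {R n X} p i {C}.
Arguments setU_slice {R n X} p i {C D}.

(** * Necessity of the conditions *)

Section Necessity.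
Context {R : realType}.

Lemma separated_sequence (X : metricType R) : ~ totally_bounded X ->
  exists2 e : R, 0 < e & exists x : nat -> X,
    forall m k, mdist (x m) (x k) < e -> m = k.
Proof.
move=> ntb; have [e e0 far] : exists2 e : R, 0 < e &
    forall s : seq X, exists x, forall y, y \in s -> e <= mdist y x.
  apply: contrapT => near; apply: ntb => e e0.
  have [s sP] : exists s : seq X, forall x, exists2 y, y \in s & mdist y x < e.
    apply: contrapT => nos; apply: near; exists e => // s.
    apply: contrapT => nox; apply: nos; exists s => x.
    apply: contrapT => noy; apply: nox; exists x => y ys.
    by rewrite leNgt; apply/negP => yx; apply: noy; exists y.
  exists [set` s]; first exact: finite_seq.
  apply/seteqP; split=> // x _; have [y ys yx] := sP x.
  by exists y => //; rewrite ballEmdist.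
exists e => //; have [g gP] := choice far.
pose s k := iter k (fun s => g s :: s) [::].
have sP m k : (m < k)%N -> g (s m) \in s k.
  elim: k => // k IH; rewrite ltnS leq_eqVlt => /predU1P[->|/IH mk].
    by rewrite /= inE eqxx.
  by rewrite /= inE mk orbT.
exists (g \o s) => m k /= mk.
have [km|km|//] := ltngtP k m.
  by have := gP _ _ (sP _ _ km); rewrite metric_sym leNgt mk.
by have := gP _ _ (sP _ _ km); rewrite leNgt mk.
Qed.

Lemma placed_factor (n : nat) (X : 'I_n -> metricType R) (b : sum_prod X) (i : 'I_n) :
  uniformly_placed (sum_prod X) -> uniformly_placed (X i).
Proof.
move=> pX C D cC cD CD e e0.
have [|d d0 dP] := pX _ _ (closed_coord cC) (closed_coord cD) _ e e0.
  by apply/seteqP; split=> // p _; have : [set: X i] (p i) by []; rewrite -CD.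
exists d => // x y Cx Dy xy; have [|||z [Cz Dz] xz] := dP (upd b x) (upd b y).
- by rewrite /= upd_eq.
- by rewrite /= upd_eq.
- by rewrite mdist_upd.
exists (z i) => //; apply: le_lt_trans xz.
by rewrite -{1}(upd_eq b x); exact: mdist_coord.
Qed.

(** If X j is not ULC, choose pairs (a_k, b_k) at distance less than 1 / (k + 1)
    split by open partitions (U_k, V_k) of the balls of radius e about a_k, and
    place the k-th ball over the ball of radius s / 2 about x k, where (x k) is
    an s-separated sequence in X i. Closed sets C and D arise by removing from
    the product the parts over all V_k, respectively all U_k; they cover
    because the columns are disjoint, and C `&` D avoids the product of the
    two balls about (x k, a_k). *)
Lemma placed_ULC_factor (n : nat) (X : 'I_n -> metricType R) (b : sum_prod X)
    (i j : 'I_n) : uniformly_placed (sum_prod X) -> i != j ->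
  ~ totally_bounded (X i) -> ULC (X j).
Proof.
move=> pX ij /separated_sequence[s s0 [x x_sep]].
apply: ULC_of_unsplit_balls => e e0; apply: contrapT => unsplit.
(* w k encodes ((a_k, b_k), (U_k, V_k)) *)
have /choice[w wP] : forall k : nat, exists w : (X j * X j) * (set (X j) * set (X j)),
    [/\ mdist w.1.1 w.1.2 < k.+1%:R^-1,
        splits [set z | mdist w.1.1 z < e] w.2.1 w.2.2, w.2.1 w.1.1 & w.2.2 w.1.2].
  move=> k; apply: contrapT => now; apply: unsplit.
  exists k.+1%:R^-1; first by rewrite invr_gt0.
  by move=> y z U V yz sUV Uy Vz; apply: now; exists ((y, z), (U, V)).
pose col k : set (sum_prod X) := [set p | mdist (x k) (p i) < s / 2].
have col_inj k l p : col k p -> col l p -> k = l.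
  move=> kp lp; apply: x_sep; have := metric_triangle (x k) (p i) (x l).
  by rewrite (metric_sym (p i)); move: kp lp; rewrite /col /=; lra.
have ocol (k : nat) : open (col k)
  by exact: (open_coord (open_mball (x k) (s / 2))).
pose C := ~` \bigcup_k (col k `&` [set p | (w k).2.2 (p j)]).
pose D := ~` \bigcup_k (col k `&` [set p | (w k).2.1 (p j)]).
have cC : closed C.
  apply: open_closedC; apply: bigcup_open => k _; apply: openI => //.
  by have [_ [oU oV _ _] _ _] := wP k; exact: (open_coord (i := j)).
have cD : closed D.
  apply: open_closedC; apply: bigcup_open => k _; apply: openI => //.
  by have [_ [oU oV _ _] _ _] := wP k; exact: (open_coord (i := j)).
have CD : C `|` D = setT.
  rewrite -setCI; apply/seteqP; split=> // p _ [[k _ [kp Vp]] [l _ [lp Up]]].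
  have kl := col_inj _ _ _ kp lp; rewrite {k}kl in kp Vp.
  have [_ [_ _ UV0 _] _ _] := wP l.
  by have : ((w l).2.1 `&` (w l).2.2) (p j) by []; rewrite UV0.
have [||r r0 [rs re]] := @pos_below R (s / 2) e; rewrite ?divr_gt0//.
have [d d0 dP] := pX C D cC cD CD r r0.
have [k kd] := invS_lt d0.
pose base := upd b (x k).
have base_i (y : X j) : upd base y i = x k.
  by rewrite upd_neq 1?eq_sym// /base upd_eq.
have col_base (y : X j) : col k (upd base y).
  by rewrite /col /= base_i mdistxx divr_gt0.
have [ab [_ _ UV0 UVB] Ua Vb] := wP k.
have [|||z [Cz Dz] az] := dP (upd base (w k).1.1) (upd base (w k).1.2).
- move=> [l _ [lp /=]]; rewrite upd_eq.
  have <- := col_inj _ _ _ (col_base _) lp.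
  by move=> Va; have : ((w k).2.1 `&` (w k).2.2) (w k).1.1 by []; rewrite UV0.
- move=> [l _ [lp /=]]; rewrite upd_eq.
  have <- := col_inj _ _ _ (col_base _) lp.
  by move=> Ub; have : ((w k).2.1 `&` (w k).2.2) (w k).1.2 by []; rewrite UV0.
- by rewrite mdist_upd; exact: lt_trans kd.
have kz : col k z.
  have := mdist_coord (upd base (w k).1.1) z i; rewrite base_i /col /=.
  by move=> xz; exact: le_lt_trans xz (lt_le_trans az rs).
have : [set y | mdist (w k).1.1 y < e] (z j).
  have := mdist_coord (upd base (w k).1.1) z j; rewrite upd_eq /=.
  by move=> xz; exact: le_lt_trans xz (lt_le_trans az re).
by rewrite -UVB => -[Uz|Vz]; [apply: Dz|apply: Cz]; exists k.
Qed.

End Necessity.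

(** * Products of ULC spaces, and with one straight factor *)

Section ULCProducts.
Context {R : realType} {n : nat} {X : 'I_n -> metricType R}.

(** The point q is brought to p by changing one coordinate at a time. If this
    leaves D at some step, the connected set in that slice crosses C `&` D;
    it cannot stay in D until the end without p being in C `&` D. *)
Lemma ULC_prod_placed : (forall i, ULC (X i)) -> uniformly_placed (sum_prod X).
Proof.
move=> ulcX.
have close (J : seq 'I_n) (e : R) : 0 < e -> exists2 d, 0 < d &
    forall (C D : set (sum_prod X)), closed C -> closed D -> C `|` D = setT ->
    forall p q : sum_prod X, (forall l, l \notin J -> p l = q l) -> C p -> D q ->
    mdist p q < d -> exists2 z, (C `&` D) z & mdist p z < e.
  elim: J e => [|i J IH] e e0.
    exists 1 => // C D _ _ _ p q pq Cp Dq _.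
    have {}pq : p = q by apply/functional_extensionality_dep => l; exact: pq.
    by exists p; [split; rewrite // pq|rewrite mdistxx].
  have e2 : 0 < e / 2 by rewrite divr_gt0.
  have [d1 d1_gt0 crossX] := ULC_crossing (ulcX i) e2.
  have [d2 d2_gt0 closeJ] := IH _ e2.
  have [r r0 [rd1 r_le]] := pos_below d1_gt0 d2_gt0.
  have [s s0 [sr se]] := pos_below r0 e2.
  exists s => // C D cC cD CD p q pq Cp Dq pqs.
  have pq' : mdist p (upd q (p i)) <= mdist p q.
    by rewrite -{1}(upd_id p i) mdist_upd2.
  have [Dq'|nDq'] := pselect (D (upd q (p i))).
    have [||z CDz pz] := closeJ C D cC cD CD p (upd q (p i)) _ Cp Dq'.
    - move=> l lJ; have [<-|il] := eqVneq i l; first by rewrite upd_eq.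
      by rewrite upd_neq// pq// inE negb_or eq_sym il.
    - by lra.
    by exists z => //; lra.
  have Cq' : C (upd q (p i)).
    by have : [set: sum_prod X] (upd q (p i)) by []; rewrite -CD => -[].
  have [||z [Cz Dz] pz] := crossX _ _ (closed_slice q i cC) (closed_slice q i cD)
    (setU_slice q i CD) (p i) (q i) Cq'.
  - by rewrite /= upd_id.
  - by have := mdist_coord p q i; lra.
  exists (upd q z) => //; have := metric_triangle p (upd q (p i)) (upd q z).
  by rewrite mdist_upd; lra.
move=> C D cC cD CD e /(close (enum 'I_n))[d d0 dP]; exists d => // p q Cp Dq.
by apply: dP => // l; rewrite mem_enum.
Qed.

(** The criterion restricted to pairs of points of the subproduct through b in
    the directions J, for covers of the whole product; d may depend on b. *)
Definition placed_along (J : seq 'I_n) := forall (b : sum_prod X) (C D : set (sum_prod X)),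
  closed C -> closed D -> C `|` D = setT -> forall e : R, 0 < e ->
  exists2 d, 0 < d & forall p q : sum_prod X,
    (forall l, l \notin J -> p l = b l) -> (forall l, l \notin J -> q l = b l) ->
    C p -> D q -> mdist p q < d -> exists2 z, (C `&` D) z & mdist p z < e.

Lemma placed_along1 j : uniformly_placed (X j) -> placed_along [:: j].
Proof.
move=> pX b C D cC cD CD e e0.
have [d d0 dP] := pX _ _ (closed_slice b j cC) (closed_slice b j cD)
  (setU_slice b j CD) e e0.
have slice (p : sum_prod X) : (forall l, l \notin [:: j] -> p l = b l) -> p = upd b (p j).
  move=> pb; apply/functional_extensionality_dep => l.
  have [<-|jl] := eqVneq j l; first by rewrite upd_eq.
  by rewrite upd_neq// pb// inE eq_sym.
exists d => // p q /slice -> /slice -> Cp Dq; rewrite mdist_upd => pq.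
have [z CDz pz] := dP _ _ Cp Dq pq.
by exists (upd b z) => //; rewrite mdist_upd.
Qed.

(** A point k of a finite net of X i is chosen near p i, and both p and q are
    moved to the slice over k, where the hypothesis on J applies. If one of
    the moves leaves its closed set, then [ULC_crossing] gives a point of
    C `&` D on the way. Only finitely many k occur, so that one d serves for
    all slices. *)
Lemma placed_along_cons i J : totally_bounded (X i) -> ULC (X i) ->
  placed_along J -> placed_along (i :: J).
Proof.
move=> tbX ulcX pJ b C D cC cD CD e e0.
have e2 : 0 < e / 2 by rewrite divr_gt0.
have e8 : 0 < e / 8 by rewrite divr_gt0.
have [d1 d1_gt0 crossX] := ULC_crossing ulcX e2.
have [r r0 [rd1 re]] := pos_below d1_gt0 e8.
have r2 : 0 < r / 2 by rewrite divr_gt0.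
have [S finS netS] := tbX _ r2.
have [k d d' d'd dP p q pb qb Cp Dq pq||d2 d2_gt0 nearS] := @common_radius R _ S
  (fun k d => forall p q : sum_prod X, (forall l, l \notin J -> p l = upd b k l) ->
    (forall l, l \notin J -> q l = upd b k l) ->
    C p -> D q -> mdist p q < d -> exists2 z, (C `&` D) z & mdist p z < e / 2) finS.
- exact: dP pb qb Cp Dq (lt_le_trans pq d'd).
- by move=> k _; exact: pJ.
have [d d0 [dd2 dr]] := pos_below d2_gt0 r2.
exists d => // p q pb qb Cp Dq pq.
have [k Sk kp] : exists2 k, S k & mdist k (p i) < r / 2.
  have : [set: X i] (p i) by []; rewrite -netS => -[k Sk].
  by rewrite ballEmdist; exists k.
have kq : mdist k (q i) < r.
  by have := metric_triangle k (p i) (q i); have := mdist_coord p q i; lra.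
have [Dp'|nDp'] := pselect (D (upd p k)).
  have [||z [Cz Dz] pz] := crossX _ _ (closed_slice p i cC) (closed_slice p i cD)
    (setU_slice p i CD) (p i) k _ Dp'.
  - by rewrite /= upd_id.
  - by rewrite metric_sym; lra.
  by exists (upd p z) => //; rewrite mdist_updr; lra.
have Cp' : C (upd p k).
  by have : [set: sum_prod X] (upd p k) by []; rewrite -CD => -[].
have [Cq'|nCq'] := pselect (C (upd q k)).
  have [||z [Cz Dz] kz] := crossX _ _ (closed_slice q i cC) (closed_slice q i cD)
    (setU_slice q i CD) k (q i) Cq'.
  - by rewrite /= upd_id.
  - by lra.
  exists (upd q z) => //; have := metric_triangle p q (upd q z).
  rewrite mdist_updr; have := metric_triangle (q i) k z.
  by rewrite (metric_sym (q i) k); lra.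
have Dq' : D (upd q k).
  by have : [set: sum_prod X] (upd q k) by []; rewrite -CD => -[].
have slice (p0 : sum_prod X) : (forall l, l \notin i :: J -> p0 l = b l) ->
    forall l, l \notin J -> upd p0 k l = upd b k l.
  move=> p0b l lJ; have [<-|il] := eqVneq i l; first by rewrite !upd_eq.
  by rewrite !upd_neq// p0b// inE negb_or eq_sym il.
have [|z CDz pz] := nearS k Sk (upd p k) (upd q k) (slice p pb) (slice q qb) Cp' Dq'.
  by have := mdist_upd2 p q k; lra.
exists z => //; have := metric_triangle p (upd p k) z.
by rewrite mdist_updr (metric_sym (p i)); lra.
Qed.

Lemma placed_prod_one_factor (b : sum_prod X) j : uniformly_placed (X j) ->
  (forall i, i <> j -> totally_bounded (X i) /\ ULC (X i)) ->
  uniformly_placed (sum_prod X).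
Proof.
move=> pX good.
have [J Jall pJ] : exists2 J, (forall l, l \in J) & placed_along J.
  exists ([seq i <- enum 'I_n | i != j] ++ [:: j]).
    by move=> l; rewrite mem_cat mem_filter mem_enum mem_seq1 /=; case: (l == j).
  have : all (predC1 j) [seq i <- enum 'I_n | i != j] by exact: filter_all.
  elim: [seq _ <- _ | _] => [_|i s IH /= /andP[/eqP/good[tbX ulcX] /IH]].
    exact: placed_along1.
  exact: placed_along_cons.
move=> C D cC cD CD e /(pJ b C D cC cD CD)[d d0 dP]; exists d => // p q.
by apply: dP => l; rewrite Jall.
Qed.

End ULCProducts.

(** * Undivided sequences of sets *)

Definition antitone_sets (T : Type) (B : nat -> set T) : Prop :=
  forall k l, (k <= l)%N -> B l `<=` B k.

(** To be read for a decreasing sequence shrinking to a point of a completion: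
    locally at this point, the space has only one side. *)
Definition undivided (T : topologicalType) (B : nat -> set T) : Prop :=
  forall U V, open U -> open V -> U `&` V = set0 ->
    (exists k, B k `<=` U `|` V) ->
    (exists k, B k `<=` U) \/ (exists k, B k `<=` V).

Section Undivided.
Context {T : topologicalType}.
Implicit Types (B Q A : nat -> set T).

Lemma undivided_shift B m :
  antitone_sets B -> undivided B -> undivided (fun k => B (m + k)%N).
Proof.
move=> antiB uB U V oU oV UV [k kUV].
have shift W : (exists k, B k `<=` W) -> exists k, B (m + k)%N `<=` W.
  by move=> [l lW]; exists l; apply: subset_trans lW; apply: antiB; exact: leq_addl.
have [|/shift ?|/shift ?] := uB U V oU oV UV; [by exists (m + k)%N|by left|by right].
Qed.

(** Suppose that Q k meets A k for all k. By local finiteness each point of Q 0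
    has a last index k with y in A k (if any), and this index is locally
    constant; so for every set M of indices, the points whose last index is in
    M and the others form an open partition of Q 0. A point of Q k `&` A k has
    last index at least k, hence there are points z_0, z_1, ... with z_k in Q k
    and with strictly increasing last indices. If M consists of the last
    indices of the z_k with k even, both parts of the partition meet every Q k,
    so Q is not undivided. *)
Lemma undivided_locally_finite Q A : antitone_sets Q -> open (Q 0%N) ->
  undivided Q -> (forall k, open (A k)) -> (forall k, open (Q 0%N `\` A k)) ->
  (forall y, Q 0%N y -> exists N, \forall y' \near y,
     forall k, (N <= k)%N -> ~ A k y') ->
  exists k, Q k `&` A k = set0.
Proof.
move=> antiQ oQ uQ oA oQA locA; apply: contrapT => meets.
have QA k : exists y, (Q k `&` A k) y.
  apply: contrapT => noy; apply: meets; exists k.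
  by apply/seteqP; split=> // y QAy; apply: noy; exists y.
have Q0 k y : Q k y -> Q 0%N y by exact: antiQ.
(* near a point of Q 0, the set of k with y in A k does not change *)
have locally_constant y : Q 0%N y ->
    \forall y' \near y, Q 0%N y' /\ forall k, A k y' <-> A k y.
  move=> Qy; have [N far] := locA y Qy.
  have nearQ : \forall y' \near y, Q 0%N y' by exact: open_nbhs_nbhs.
  have nearA : \forall y' \near y, forall k : 'I_N, A k y' <-> A k y.
    apply: filter_forall => k; have [Aky|nAky] := pselect (A k y).
      by apply: filterS (open_nbhs_nbhs (conj (oA k) Aky)) => y'.
    have QAy : (Q 0%N `\` A k) y by [].
    by apply: filterS (open_nbhs_nbhs (conj (oQA k) QAy)) => y' [].
  have farA := nbhs_singleton far.
  apply: filterS3 nearQ nearA far => y' Qy' AA' farA'; split=> // k.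
  have [kN|Nk] := ltnP k N; first exact: AA' (Ordinal kN).
  by split=> [/(farA' k Nk)|/(farA k Nk)].
pose last y k := A k y /\ forall l, (k < l)%N -> ~ A l y.
have last_inj y k l : last y k -> last y l -> k = l.
  move=> [Ak nAk] [Al nAl]; have [kl|lk|//] := ltngtP k l.
    by have := nAk l kl.
  by have := nAl k lk.
have last_ex k y : Q k y -> A k y -> exists2 l, (k <= l)%N & last y l.
  move=> /Q0 Qy Ak; have [N /nbhs_singleton far] := locA y Qy.
  have exA : exists l, `[< A l y >] by exists k; apply/asboolP.
  have ubA l : `[< A l y >] -> (l <= N)%N.
    by move=> /asboolP Al; rewrite leqNgt; apply/negP => /ltnW/far.
  case: (ex_maxnP exA ubA) => l /asboolP Al maxl.
  exists l; first by apply: maxl; apply/asboolP.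
  by split=> // r lr /asboolP/maxl; rewrite leqNgt lr.
have last_split M : (exists k, Q k `<=` [set y | exists2 l, M l & last y l]) \/
    (exists k, Q k `<=` [set y | ~ exists2 l, M l & last y l]).
  pose U := Q 0%N `&` [set y | exists2 l, M l & last y l].
  pose V := Q 0%N `&` [set y | ~ exists2 l, M l & last y l].
  have same y y' : (forall k, A k y' <-> A k y) -> forall l, last y l -> last y' l.
    by move=> AA l [Al nAl]; split=> [|r lr]; rewrite AA//; exact: nAl.
  have oU : open U.
    rewrite openE => y [Qy [l Ml yl]].
    apply: filterS (locally_constant y Qy) => y' [Qy' AA]; split=> //.
    by exists l => //; exact: same yl.
  have oV : open V.
    rewrite openE => y [Qy ny].
    apply: filterS (locally_constant y Qy) => y' [Qy' AA]; split=> //.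
    by move=> [l Ml y'l]; apply: ny; exists l => //; apply: same y'l => k; rewrite AA.
  have [||[k kU]|[k kV]] := uQ U V oU oV.
  - by apply/seteqP; split=> // y [[_ Uy] [_ /(_ Uy)]].
  - exists 0%N => y Qy.
    by have [My|nMy] := pselect (exists2 l, M l & last y l); [left|right].
  - by left; exists k => y /kU[].
  - by right; exists k => y /kV[].
have /choice[y yP] := QA.
have /choice[u uP] : forall k, exists l, (k <= l)%N /\ last (y k) l.
  by move=> k; have [Qk Ak] := yP k; have [l] := last_ex k (y k) Qk Ak; exists l.
(* a subsequence of the points y along which their last indices increase *)
pose c k := iter k (fun m => (u m).+1) 0%N.
have c_lt k : (u (c k) < c k.+1)%N by [].
have c_ge k : (k <= c k)%N.
  by elim: k => // k IH; apply: leq_ltn_trans IH (leq_ltn_trans (uP _).1 (c_lt k)).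
have uc_lt k l : (k < l)%N -> (u (c k) < u (c l))%N.
  elim: l => // l IH; rewrite ltnS leq_eqVlt => /predU1P[->|/IH kl].
    exact: leq_trans (c_lt l) (uP _).1.
  by apply: ltn_trans kl _; exact: leq_trans (c_lt l) (uP _).1.
have uc_inj k l : u (c k) = u (c l) -> k = l.
  by move=> kl; have [/uc_lt|/uc_lt|//] := ltngtP k l; rewrite kl ltnn.
pose M := [set u (c k) | k in [set k | ~~ odd k]].
have Qc k l : (k <= l)%N -> Q k (y (c l)).
  by move=> kl; apply: antiQ (yP (c l)).1; exact: leq_trans (c_ge l).
have [[k kM]|[k kM]] := last_split M.
  have [|_ [l /= even_l <-]] := kM (y (c k.*2.+1)).
    by apply: Qc; rewrite -addnn -addnS leq_addr.
  move=> /(last_inj _ _ _ (uP (c k.*2.+1)).2)/uc_inj kl.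
  by move: even_l; rewrite -kl /= odd_double.
apply: (kM (y (c k.*2))); first by apply: Qc; rewrite -addnn leq_addr.
exists (u (c k.*2)); last exact: (uP _).2.
by exists k.*2; rewrite //= odd_double.
Qed.

End Undivided.

(** * Completion points of straight spaces *)

Section RoundCauchy.
Context {R : realType} {X : metricType R}.

(** If neither U nor V contained a B l, there would be points of U and of V in
    every B l, thus arbitrarily close to each other. The complements of V and
    U inside the interior of B k are closed sets that cover X and meet only
    outside this interior, while the points are well inside. *)
Lemma placed_undivided (B : nat -> set X) : uniformly_placed X ->
  antitone_sets B ->
  (forall k, exists l, exists2 e : R, 0 < e &
     forall x y, B l x -> mdist x y < e -> B k y) ->
  (forall e : R, 0 < e -> exists k, forall x y, B k x -> B k y -> mdist x y < e) ->
  undivided B.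
Proof.
move=> pX antiB roundB cauchyB U V oU oV UV0 [k kUV].
apply: contrapT => /not_orP[nU nV].
have out W l : ~ (exists k, B k `<=` W) -> exists2 x, B l x & ~ W x.
  move=> nW; apply: contrapT => nox; apply: nW; exists l => x Bx.
  by apply: contrapT => nWx; apply: nox; exists x.
have [m [e e0 mk]] := roundB k.
pose Bo := (B k)°.
have oBo : open Bo by exact: open_interior.
have BoB : Bo `<=` B k by exact: interior_subset.
have UVBo : ~` (V `&` Bo) `&` ~` (U `&` Bo) = ~` Bo.
  rewrite -setCU -setIUl setUC; congr (~` _); apply/setIidPr => x /BoB.
  exact: kUV.
have [||||d d0 dP] := pX (~` (V `&` Bo)) (~` (U `&` Bo)) _ _ _ (e / 2).
- by apply: open_closedC; exact: openI.
- by apply: open_closedC; exact: openI.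
- by rewrite -setCI setIACA (setIC V) UV0 set0I setC0.
- by rewrite divr_gt0.
have [l small] := cauchyB d d0.
pose r := maxn (maxn k l) m.
have [rk rl rm] : [/\ k <= r, l <= r & m <= r]%N.
  by rewrite /r !leq_max !leqnn ?orbT.
have [x Brx nVx] := out V r nV; have [y Bry nUy] := out U r nU.
have [|||z] := dP x y.
- by move=> [].
- by move=> [].
- by apply: small; exact: (antiB _ _ rl).
rewrite UVBo => nBoz xz; apply: nBoz.
apply/metricType_numDomainType.nbhs_mdistP; exists (e / 2); rewrite /= ?divr_gt0//.
move=> w /= zw; apply: mk (antiB _ _ rm _ Brx) _.
by have := metric_triangle x z w; lra.
Qed.

End RoundCauchy.

Section Germs.
Context {R : realType}.

(** The open ball of radius 1 / (k + 1) about the limit of x along F, where the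
    limit is taken in the completion of X. The margin e makes it open. *)
Definition germ (I : Type) (X : metricType R) (F : set_system I) (x : I -> X)
    (k : nat) : set X :=
  [set z | exists2 e : R, 0 < e & F [set m | mdist (x m) z + e < k.+1%:R^-1]].

Context {I : Type} {X : metricType R} (F : set_system I) {FF : ProperFilter F}.
Implicit Types (x : I -> X).

Lemma lef_invS k l : (k <= l)%N -> l.+1%:R^-1 <= k.+1%:R^-1 :> R.
Proof. by move=> kl; rewrite lef_pV2 ?posrE// ler_nat. Qed.

Lemma germ_antitone x : antitone_sets (germ F x).
Proof.
move=> k l kl z [e e0 Fe]; exists e => //; apply: filterS Fe => m /= h.
exact: lt_le_trans h (lef_invS kl).
Qed.

Lemma germ_near x k z : germ F x k z -> F [set m | mdist (x m) z < k.+1%:R^-1].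
Proof.
move=> [e e0]; apply: filterS => m /=; apply: le_lt_trans.
by rewrite lerDl ltW.
Qed.

Lemma germ_open x k : open (germ F x k).
Proof.
apply/open_mdistP => z [e e0 Fe]; exists (e / 2); first by rewrite divr_gt0.
move=> w zw; exists (e / 2); first by rewrite divr_gt0.
apply: filterS Fe => m /=; have := metric_triangle (x m) z w.
by move: zw; move: (k.+1%:R^-1) => q; lra.
Qed.

Lemma germ_round x k : exists l, exists2 e : R, 0 < e &
  forall z w, germ F x l z -> mdist z w < e -> germ F x k w.
Proof.
exists k.+1, (k.+1%:R^-1 - k.+2%:R^-1).
  by rewrite subr_gt0 ltf_pV2 ?posrE// ltr_nat.
move=> z w [e e0 Fe] zw; exists e => //.
apply: filterS Fe => m /=; have := metric_triangle (x m) z w.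
by move: zw; move: (k.+1%:R^-1) (k.+2%:R^-1) => a b; lra.
Qed.

Lemma germ_cauchy x (e : R) : 0 < e -> exists k, forall z w,
  germ F x k z -> germ F x k w -> mdist z w < e.
Proof.
move=> e0; have [|k ke] := @invS_lt R (e / 2); first by rewrite divr_gt0.
exists k => z w /germ_near Fz /germ_near Fw.
have [m [/= mz mw]] := filter_ex (filterI Fz Fw).
have := metric_triangle z (x m) w; rewrite (metric_sym z (x m)).
by move: ke mz mw; move: (k.+1%:R^-1) => q; lra.
Qed.

Lemma germ_undivided x : uniformly_placed X -> undivided (germ F x).
Proof.
move=> pX; apply: placed_undivided => //; first exact: germ_antitone.
  exact: germ_round.
exact: germ_cauchy.
Qed.

End Germs.

(** An ultrafilter contains one member of any finite cover, so x is Cauchy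
    along F and its terms enter every ball about their limit. *)
Lemma germ_totally_bounded (R : realType) (I : Type) (X : metricType R)
    (F : set_system I) (x : I -> X) k : UltraFilter F -> totally_bounded X ->
  F [set m | germ F x k (x m)].
Proof.
move=> FU tbX; pose r : R := k.+1%:R^-1 / 4.
have r0 : 0 < r by rewrite !divr_gt0 ?invr_gt0.
have [S finS netS] := tbX r r0.
have [s Ss Fs] : exists2 s, S s & F [set m | mdist s (x m) < r].
  apply: contrapT => nos; have /finite_fsetP[D SD] := finS.
  have : F (\bigcap_(s in S) [set m | ~ mdist s (x m) < r]).
    rewrite SD; apply: filter_bigI => s sD; have Ss : S s by rewrite SD.
    have [Fs|//] := in_ultra_setVsetC [set m | mdist s (x m) < r] FU.
    by exfalso; apply: nos; exists s.
  move=> /filter_ex[m far]; have : [set: X] (x m) by [].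
  by rewrite -netS => -[s Ss]; rewrite ballEmdist; exact: far.
apply: (filterS _ Fs) => m /= sm; exists r => //.
apply: filterS Fs => l /= sl; have := metric_triangle (x l) s (x m).
by move: r0 sl sm; rewrite (metric_sym (x l) s) /r; move: (k.+1%:R^-1) => q; lra.
Qed.

(** * Products of totally bounded straight spaces *)

Section Boxes.
Context {R : realType} {n : nat} {X : 'I_n -> metricType R}.
Implicit Types (B : forall i, nat -> set (X i)) (p q : sum_prod X).

Definition box B (k : nat) : set (sum_prod X) := [set p | forall i, B i k (p i)].

Definition point_balls i (y : X i) (k : nat) : set (X i) :=
  [set x | mdist y x < k.+1%:R^-1].

Definition solid i (B : nat -> set (X i)) : Prop :=
  [/\ antitone_sets B, forall k, open (B k), forall k, B k !=set0 & undivided B].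

Lemma solid_point_balls i (y : X i) : solid (point_balls y).
Proof.
have center k : point_balls y k y.
  by rewrite /point_balls /= mdistxx invr_gt0.
split.
- by move=> k l kl x /= yx; exact: lt_le_trans yx (lef_invS kl).
- by move=> k; exact: open_mball.
- by move=> k; exists y.
- move=> U V oU oV _ [k kUV].
  have inner W : open W -> W y -> exists k, point_balls y k `<=` W.
    move=> /open_mdistP oW /oW[e e0 eW]; have [l le] := invS_lt e0.
    by exists l => x /= yx; apply: eW; exact: lt_trans le.
  by have [/inner|/inner] := kUV y (center k); [left|right]; auto.
Qed.

Lemma small_box (e : R) : 0 < e -> exists k : nat, forall p q,
  (forall i, mdist (p i) (q i) < k.+1%:R^-1) -> mdist p q < e.
Proof.
move=> e0; have [|k ke] := @invS_lt R (e / n.+1%:R); first by rewrite divr_gt0.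
exists k => p q pq; rewrite mdist_prodE.
apply: (@le_lt_trans _ _ (\sum_(i < n) e / n.+1%:R)).
  by apply: ler_sum => i _; exact: ltW (lt_trans (pq i) ke).
rewrite sumr_const card_ord -[_ *+ n]mulr_natl mulrA ltr_pdivrMr// mulrC.
by rewrite ltr_pM2l// ltr_nat.
Qed.

Lemma box_antitone B :
  (forall i, antitone_sets (B i)) -> antitone_sets (box B).
Proof. by move=> antiB k l kl p Bp i; exact: antiB kl _ (Bp i). Qed.

Lemma box_nonempty B k : (forall i, solid (B i)) -> exists p, box B k p.
Proof.
move=> sB; have ne i : B i k !=set0 by have [] := sB i.
exists (fun i => sval (cid (ne i))) => i.
exact: (svalP (cid (ne i))).
Qed.

(** The points y of the i-th factor over a neighbourhood of which W contains a
    whole box of the other coordinates. *)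
Definition thick_slice B i (W : set (sum_prod X)) : set (X i) :=
  \bigcup_k [set y | forall p, box B k p -> W (upd p y)]°.

Arguments thick_slice : clear implicits.

(** Otherwise every box contains a point p k outside U, hence in V if the box is
    small. The sets A k of those y in B i for which p k, with i-th coordinate
    changed to y, is in V, are clopen in B i and contain the i-th coordinate of p k.
    They are locally finite because each y in B i has a neighbourhood over
    which all small boxes are contained in U. This contradicts
    [undivided_locally_finite]. *)
Lemma box_subset_of_thick B i (U V : set (sum_prod X)) :
  (forall i, solid (B i)) -> open U -> open V -> U `&` V = set0 ->
  (exists k, box B k `<=` U `|` V) -> (exists k, B i k `<=` thick_slice B i U) ->
  exists k, box B k `<=` U.
Proof.
move=> sB oU oV UV0 [k0 kUV] [k1 kU]; apply: contrapT => noU.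
have [antiB oB _ uB] := sB i.
have antibox : antitone_sets (box B).
  by apply: box_antitone => j; have [] := sB j.
pose m := maxn k0 k1.
have [m0 m1] : (k0 <= m)%N /\ (k1 <= m)%N by rewrite /m leq_maxl leq_maxr.
have UVE p : box B m p -> U p \/ V p by move=> /(antibox _ _ m0)/kUV.
have UVN p : U p -> ~ V p by move=> Up Vp; have : (U `&` V) p by []; rewrite UV0.
have /choice[p pP] : forall k, exists p, box B (m + k)%N p /\ ~ U p.
  move=> k; apply: contrapT => nop; apply: noU; exists (m + k)%N => p Bp.
  by apply: contrapT => nUp; apply: nop; exists p.
have boxp k y : B i m y -> box B m (upd (p k) y).
  move=> Bmy j; have [<-|ij] := eqVneq i j; first by rewrite upd_eq.
  rewrite upd_neq//; have [Bp _] := pP k.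
  by apply: (antibox m (m + k)%N) => //; exact: leq_addr.
pose Q k := B i (m + k)%N.
have Q0 y : Q 0%N y = B i m y by rewrite /Q addn0.
pose A k := Q 0%N `&` [set y | V (upd (p k) y)].
have [k QA] : exists k, Q k `&` A k = set0.
  apply: undivided_locally_finite.
  - by move=> k l kl; apply: antiB; rewrite leq_add2l.
  - exact: oB.
  - exact: undivided_shift.
  - by move=> k; apply: openI; [exact: oB|exact: open_slice].
  - move=> k; have -> : Q 0%N `\` A k = Q 0%N `&` [set y | U (upd (p k) y)].
      apply/seteqP; split=> y [Qy].
        move=> nAy; split=> //; have Bmy : B i m y by rewrite -Q0.
        by have [//|Vy] := UVE _ (boxp k y Bmy); exfalso; apply: nAy.
      by move=> Uy; split=> // -[_]; exact: UVN.
    by apply: openI; [exact: oB|exact: open_slice].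
  - move=> y; rewrite Q0 => /(antiB _ _ m1)/kU[N _ nearU]; exists N.
    apply: filterS nearU => y' inU k Nk [_ Vy']; apply: UVN (Vy'); apply: inU.
    have [Bp _] := pP k; apply: antibox Bp.
    by rewrite (leq_trans Nk)// leq_addl.
have [Bp nUp] := pP k.
suff : (Q k `&` A k) (p k i) by rewrite QA.
have Bmp : box B m (p k) by apply: antibox Bp; exact: leq_addr.
split; first exact: Bp.
split; first by rewrite Q0; exact: Bmp.
by rewrite /= upd_id; have [] := UVE _ Bmp.
Qed.

(** For y in B i, the hypothesis says that the box about y in direction i lies
    on one side, U or V. Both cases are open conditions on y and they exclude
    each other, so B i, being undivided, ends up in one case. *)
Lemma box_undivided_step B i : (forall j, solid (B j)) ->
  (forall y, undivided (box (dfwith B i (point_balls y)))) -> undivided (box B).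
Proof.
move=> sB uBy U V oU oV UV0 [k0 kUV].
have [antiB oB _ uB] := sB i.
have antibox : antitone_sets (box B).
  by apply: box_antitone => j; have [] := sB j.
have thickP W y k : box (dfwith B i (point_balls y)) k `<=` W -> thick_slice B i W y.
  move=> kW; exists k => //; apply/metricType_numDomainType.nbhs_mdistP.
  exists k.+1%:R^-1; first by rewrite /= invr_gt0.
  move=> z yz p Bp; apply: kW => j; have [<-|ij] := eqVneq i j.
    by rewrite upd_eq dfwithin.
  by rewrite upd_neq// dfwithout.
have thickUV : B i k0 `<=` thick_slice B i U `|` thick_slice B i V.
  move=> y By; have [l lB] : exists l, point_balls y l `<=` B i k0.
    have [e e0 eB] := (open_mdistP _).1 (oB k0) y By.
    by have [l le] := invS_lt e0; exists l => z /= yz; apply: eB; exact: lt_trans le.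
  have [|[k kW]|[k kW]] := uBy y U V oU oV UV0; [|by left; exact: thickP kW|
    by right; exact: thickP kW].
  exists (maxn k0 l) => p Bp; apply: kUV => j.
  have := Bp j; have [<-|ij] := eqVneq i j.
    rewrite dfwithin => yp; apply: lB; apply: lt_le_trans yp (lef_invS _).
    exact: leq_maxr.
  by rewrite dfwithout//; have [antiBj _ _ _] := sB j; apply: antiBj; exact: leq_maxl.
have [|||||] := uB (thick_slice B i U) (thick_slice B i V).
- by apply: bigcup_open => k _; exact: open_interior.
- by apply: bigcup_open => k _; exact: open_interior.
- apply/seteqP; split=> // y [[k _ /interior_subset kU] [l _ /interior_subset lV]].
  have [p Bp] := box_nonempty (maxn k l) sB.
  have : (U `&` V) (upd p y); last by rewrite UV0.
  split; [apply: kU|apply: lV]; apply: antibox Bp; [exact: leq_maxl|exact: leq_maxr].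
- by exists k0.
- move=> thickU; left; apply: box_subset_of_thick oU oV UV0 _ thickU => //.
  by exists k0.
- move=> thickV; right; apply: box_subset_of_thick oV oU _ _ thickV => //.
    by rewrite setIC.
  by exists k0; rewrite setUC.
Qed.

Lemma box_point_undivided B (b : sum_prod X) :
  (forall i, B i = point_balls (b i)) -> undivided (box B).
Proof.
move=> Bb U V oU oV _ [k kUV].
have inner W : open W -> W b -> exists k, box B k `<=` W.
  move=> /open_mdistP oW /oW[e /small_box[l le] eW].
  by exists l => p Bp; apply/eW/le => i; have := Bp i; rewrite Bb.
have [|/inner|/inner] := kUV b; [|by left; auto|by right; auto].
by move=> i; rewrite Bb /point_balls /= mdistxx invr_gt0.
Qed.

(** Induction on the number m of coordinates in which the sequence may shrink
    to a completion point rather than to a point of the space. *)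
Lemma box_undivided B : (forall i, solid (B i)) -> undivided (box B).
Proof.
suff boxm m : forall B, (forall i, solid (B i)) ->
    (forall i : 'I_n, (m <= i)%N -> exists y, B i = point_balls y) -> undivided (box B).
  by move=> sB; apply: (boxm n) => // i; rewrite leqNgt ltn_ord.
elim: m => [|m IH] {}B sB pB.
  have pB' i := cid (pB i isT).
  by apply: (@box_point_undivided B (fun i => sval (pB' i))) => i; exact: svalP (pB' i).
have [mn|nm] := ltnP m n; last first.
  by apply: IH => // i mi; have := leq_trans nm mi; rewrite leqNgt ltn_ord.
apply: (@box_undivided_step B (Ordinal mn)) => // y; apply: IH => j.
  have [<-|ij] := eqVneq (Ordinal mn) j; last by rewrite dfwithout.
  by rewrite dfwithin; exact: solid_point_balls.
have [<- _|ij mj] := eqVneq (Ordinal mn) j; first by rewrite dfwithin; exists y.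
by rewrite dfwithout//; apply: pB; rewrite ltn_neqAle mj andbT.
Qed.

End Boxes.

(** Pairs of points violating the criterion converge, along an ultrafilter, to
    one point of the completion of the product, about which C `&` D is empty.
    The complements of D and C are then disjoint open sets that cover a box
    about it, and [box_undivided] makes one of them contain a smaller box.
    But such a box contains points of C and of D. *)
Lemma totally_bounded_prod_placed (R : realType) (n : nat)
    (X : 'I_n -> metricType R) :
  (forall i, uniformly_placed (X i)) -> (forall i, totally_bounded (X i)) ->
  uniformly_placed (sum_prod X).
Proof.
move=> pX tbX C D cC cD CD e e0; apply: contrapT => nod.
have /choice[w wP] : forall k : nat, exists w : sum_prod X * sum_prod X,
    [/\ C w.1, D w.2, mdist w.1 w.2 < k.+1%:R^-1 &
        forall z, mdist w.1 z < e -> ~ (C `&` D) z].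
  move=> k; apply: contrapT => now; apply: nod.
  exists k.+1%:R^-1; first by rewrite invr_gt0.
  move=> p q Cp Dq pq; apply: contrapT => noz; apply: now; exists (p, q).
  by split=> // z pz CDz; apply: noz; exists z.
have [F [FU Foo]] := ultraFilterLemma (eventually_filter : ProperFilter \oo).
pose B i := germ F (fun k => (w k).1 i).
have Bw1 k : F [set m | box B k (w m).1].
  by apply: filter_forall => i; exact: germ_totally_bounded.
have Bw2 k : F [set m | box B k (w m).2].
  apply: filter_forall => i.
  have [l [r r0 lk]] := germ_round (F := F) (fun k => (w k).1 i) k.
  have near : F [set m : nat | m.+1%:R^-1 < r].
    by apply: Foo; exact: (near_infty_natSinv_lt (PosNum r0)).
  apply: filterS2 (Bw1 l) near => m Bm mr; apply: lk (Bm i) _.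
  have [_ _ pq _] := wP m; apply: le_lt_trans (mdist_coord _ _ _) _.
  exact: lt_trans mr.
have sB i : solid (B i).
  split; [exact: germ_antitone|exact: germ_open| |exact: germ_undivided].
  by move=> k; have [m Bm] := filter_ex (Bw1 k); exists ((w m).1 i); exact: Bm.
have [||[k kD]|[k kC]] := box_undivided sB (closed_openC cD) (closed_openC cC).
- by rewrite -setCU setUC CD setCT.
- have [k small] := @small_box R n X e e0; exists k => z Bz.
  have : F [set m | forall i, mdist ((w m).1 i) (z i) < k.+1%:R^-1].
    by apply: filter_forall => i; exact: germ_near (Bz i).
  move=> /filter_ex[m /small wz]; have [_ _ _ /(_ z wz) nCD] := wP m.
  by rewrite -setCI setIC.
- have [m /kD] := filter_ex (Bw2 k); by have [] := wP m.
- have [m /kC] := filter_ex (Bw1 k); by have [] := wP m.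
Qed.

Theorem corollary1 (R : realType) (n : nat) (hn : (1 <= n)%N)
    (X : 'I_n -> metricType R) (hX : forall i, [set: X i] !=set0) :
  straight (sum_prod X) <->
    (forall i, straight (X i)) /\
    [\/ forall i, totally_bounded (X i),
        forall i, ULC (X i) |
        exists j, forall i, i <> j -> totally_bounded (X i) /\ ULC (X i)].
Proof.
have b : sum_prod X := fun i => sval (cid (hX i)).
rewrite straightP; split=> [pX|[sX]]; last first.
  have pX i : uniformly_placed (X i) by apply/straightP.
  case=> [tbX|ulcX|[j good]].
  - exact: totally_bounded_prod_placed.
  - exact: ULC_prod_placed.
  - exact: (placed_prod_one_factor b (pX j) good).
split; first by move=> i; apply/straightP; exact: placed_factor pX.
(* a factor that is not totally bounded makes all the others ULC; the three
   alternatives are the case distinction drawn from this *)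
have ulcX i j : i != j -> totally_bounded (X i) \/ ULC (X j).
  move=> ij; have [tbX|ntbX] := pselect (totally_bounded (X i)); first by left.
  by right; exact: placed_ULC_factor pX ij ntbX.
have [tbX|/existsNP[j ntbX]] := pselect (forall i, totally_bounded (X i)).
  exact: Or31.
have ulc_other i : i != j -> ULC (X i).
  by move=> ij; have [|/ntbX|] := ulcX j i; rewrite 1?eq_sym.
have [ulcj|nulcj] := pselect (ULC (X j)).
  by apply: Or32 => i; have [->//|/ulc_other] := eqVneq i j.
apply: Or33; exists j => i /eqP ij; split; last exact: ulc_other.
by have [|/nulcj] := ulcX i j ij.
Qed.
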